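(* Let $p$ be a prime number and let $P(x)\in\mathbb{Z}[x]$ be a $p$-special polynomial. Then for every integer $\ell\geq 1$ we have $|\operatorname{Res}(P,\Phi_\ell)|>1$, where $\Phi_\ell$ is the $\ell$-th cyclotomic polynomial.
   Context: A monic polynomial $P(x)=x^i+A_{i-1}x^{i-1}+\dots+A_1x+A_0\in\mathbb{Z}[x]$ is called $p$-special (for a prime $p$) if (i) $v_p(A_{i-1})>v_p(2)$, and (ii) $v_p(A_j)>v_p(A_{i-1})$ for $j=0,1,\dots,i-2$. Here $v_p$ is the $p$-adic valuation with $v_p(0)=+\infty$.
   Formalization: The polynomial P(x) = x is excluded: with v_p(0) = +∞ it is p-special for every p (degree 1, A_0 = 0), yet |Res(x, Φ_ℓ)| = |Φ_ℓ(0)| = 1 for every ℓ, so the claim as stated fails for it. *)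

(* Defs.v *)
From HB Require Import structures.
From mathcomp Require Import all_boot all_order all_algebra all_field.
From mathcomp Require Import constructive_ereal.
Set Implicit Arguments.
Unset Strict Implicit.
Unset Printing Implicit Defensive.
Import Order.TTheory GRing.Theory Num.Theory.
Local Open Scope ring_scope.

Definition padicv (p : nat) (a : int) : \bar int :=
  if a == 0 then +oo%E else ((logn p `|a|%N)%:Z)%:E.

(* The degree i is (size P).-1; i >= 1 is required for A_(i-1) to exist. *)
Definition pspecial (p : nat) (P : {poly int}) : Prop :=
  let i := (size P).-1 in
  [/\ P \is monic,
      (1 <= i)%N,
      (padicv p 2 < padicv p P`_(i - 1))%E &
      forall j : nat, (j < i - 1)%N ->
        (padicv p P`_(i - 1) < padicv p P`_j)%E].

(* Main.v *)
Require Import Defs.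
From HB Require Import structures.
From mathcomp Require Import all_boot all_order all_algebra all_field.
From mathcomp Require Import constructive_ereal ring zify.
Import Order.TTheory GRing.Theory Num.Theory.
Local Open Scope ring_scope.

(** Let z be a primitive l-th root of unity and write
    P = X^(i+1) + q (a X^i + p R), where q > 2 is a power of p and p does not
    divide a.  If the resultant is 0 or 1 or -1, then, for a suitable z,
    u = P(z) / z^(i+1) = 1 + q (a / z + p R(z) / z^(i+1)) is 0 or a unit; it is
    not 0 since it is 1 modulo q.  An algebraic integer all of whose conjugates
    have modulus less than 1 is 0.  Applied to (u - u^* ) / (q u^* ), this shows
    that u is real; comparing u with u^* then gives that p divides z - 1/z.  The
    same principle applied to (z^2 - 1) / p for p odd, and to (z^4 - 1) / 4 for
    p = 2, shows that z^2 = 1 or that p = 2 and z^2 = -1.  These cases are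
    excluded by congruences modulo q and p. *)

(** * Algebraic integers with small conjugates *)

(** The splitting field of the minimal polynomial of [x] is Galois, since the characteristic is 0.
    It is the field in which the norm of [x] is taken. *)
Lemma normal_num_field_exists (x : algC) :
  exists (Qn : splittingFieldType rat) (QnC : {rmorphism Qn -> algC}) (a : Qn),
    galois 1 {:Qn} /\ QnC a = x.
Proof.
have [q [Dq mon_q] min_q] := minCpolyP x.
have [s Ds] := closed_field_poly_normal (minCpoly x).
rewrite (monicP (minCpoly_monic x)) scale1r in Ds.
have [Qn [QnC [s1 Ds1 genQn]]] := num_field_exists s.
pose r := \prod_(y <- s1) ('X - y%:P).
have Dr : r = map_poly (in_alg Qn) q.
  apply: (map_poly_inj QnC); rewrite -map_poly_comp.
  rewrite (_ : map_poly QnC r = minCpoly x); last first.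
    rewrite Ds -Ds1 big_map rmorph_prod; apply: eq_bigr => y _ /=.
    by rewrite map_polyXsubC.
  rewrite Dq; apply: eq_map_poly => b /=.
  by rewrite rmorphZ_num rmorph1 mulr1.
have Q_r : r \is a polyOver 1%AS.
  by rewrite Dr; apply/polyOverP => i; rewrite coef_map /= memvZ // rpred1.
have split_r : splittingFieldFor 1 r {:Qn} by exists s1; rewrite ?eqpxx.
have Qn_ax : FieldExt_isSplittingField _ Qn by constructor; exists r.
have : x \in s by rewrite -root_prod_XsubC -Ds root_minCpoly.
rewrite -Ds1 => /mapP[a _ Da].
exists (HB.pack_for (splittingFieldType rat) Qn Qn_ax), QnC, a; split=> //.
rewrite /galois sub1v /=; apply/andP; split.
  apply/separableP => y _; apply: contraT => /separablePn_pchar[p].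
  by rewrite -(fmorph_pchar QnC) Cpchar.
apply/splitting_normalField; first exact: sub1v.
by exists r.
Qed.

(** The norm of [x] to the rationals is a rational integer and a product of conjugates of [x], so
    its modulus is less than 1 and it vanishes. *)
Lemma Aint_small_conjugates (x : algC) :
  x \in Aint -> (forall nu : {rmorphism algC -> algC}, `|nu x| < 1) -> x = 0.
Proof.
move=> Ax small; have [Qn [QnC [a [galQn Da]]]] := normal_num_field_exists x.
(* Each Galois automorphism extends to [algC], where the bound on conjugates is assumed. *)
have nuP (f : gal_of {:Qn}) := extend_algC_subfield_aut QnC f.
pose N := galNorm 1 {:Qn} a.
have DN : QnC N = \prod_(f in 'Gal({:Qn} / 1)%g) sval (nuP f) x.
  rewrite rmorph_prod; apply: eq_bigr => f _.
  by case: (nuP f) => nu /= ->; rewrite Da.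
have ratN : QnC N \in Crat.
  have : N \in fixedField 'Gal({:Qn} / 1)%g by rewrite galNorm_fixedField ?memvf.
  rewrite (galois_fixedField galQn) => /vlineP[b ->].
  by rewrite rmorphZ_num rmorph1 mulr1 Crat_rat.
have intN : QnC N \in Num.int.
  apply: Cint_rat_Aint ratN _; rewrite DN; apply: rpred_prod => f _.
  by rewrite Aint_aut.
have [/eqP|nzN] := eqVneq (QnC N) 0.
  by rewrite fmorph_eq0 galNorm_eq0 -(fmorph_eq0 QnC) Da => /eqP.
have := norm_intr_ge1 intN nzN; suff /lt_geF-> : `|QnC N| < 1 by [].
(* The identity factor gives the strict inequality; the other factors are at most 1. *)
rewrite DN normr_prod (bigD1 (1%g : gal_of {:Qn})) ?group1 //=.
apply: le_lt_trans (small (sval (nuP 1%g))).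
rewrite ler_piMr //; apply: prodr_ile1 => f _; rewrite normr_ge0 /=.
exact: ltW.
Qed.

(** * Integer polynomials at algebraic integers *)

Local Notation pZtoC := (map_poly (intr : int -> algC)).

Lemma Aint_horner (f : {poly int}) (z : algC) :
  z \in Aint -> (pZtoC f).[z] \in Aint.
Proof.
move=> Az; rewrite horner_coef; apply: rpred_sum => i _.
by rewrite coef_map rpredM ?rpredX // Aint_int.
Qed.

Lemma Cint_horner (f : {poly int}) (z : algC) :
  z \is a Num.int -> (pZtoC f).[z] \is a Num.int.
Proof. by case/intrP=> m ->; rewrite horner_map intr_int. Qed.

Lemma aut_horner (nu : {rmorphism algC -> algC}) (f : {poly int}) (z : algC) :
  nu (pZtoC f).[z] = (pZtoC f).[nu z].
Proof.
rewrite -horner_map /= -map_poly_comp; congr _.[_]; apply: eq_map_poly => m /=.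
by rewrite rmorph_int.
Qed.

(** Even powers cancel in the difference and odd powers are doubled. *)
Lemma Aint_horner_oppB (f : {poly int}) (z : algC) :
  z \in Aint -> ((pZtoC f).[- z] - (pZtoC f).[z]) / 2 \in Aint.
Proof.
move=> Az; rewrite !horner_coef -sumrB mulr_suml; apply: rpred_sum => i _.
rewrite coef_map -mulrBr -mulrA rpredM ?Aint_int //= exprNn -signr_odd.
case: (odd i); last by rewrite mul1r subrr mul0r.
have -> : (-1) ^+ true * z ^+ i - z ^+ i = - z ^+ i * 2.
  by rewrite mulN1r mulr_natr mulr2n.
by rewrite mulfK ?pnatr_eq0 // rpredN rpredX.
Qed.

(** * Roots of unity and congruences *)

Lemma norm_root1 (n : nat) (z : algC) : (0 < n)%N -> z ^+ n = 1 -> `|z| = 1.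
Proof.
by move=> n_gt0 zn1; apply/eqP; rewrite -(pexpr_eq1 n_gt0) // -normrX zn1 normr1.
Qed.

Lemma conj_root1 (n : nat) (z : algC) :
  (0 < n)%N -> z ^+ n = 1 -> z^* = z^-1.
Proof.
move=> n_gt0 zn1.
by rewrite invC_norm (norm_root1 _ _ n_gt0 zn1) expr1n invr1 mul1r.
Qed.

Lemma Aint_root1 (n : nat) (z : algC) : (0 < n)%N -> z ^+ n = 1 -> z \in Aint.
Proof. by move=> n_gt0 /unity_rootP; apply: Aint_unity_root. Qed.

Lemma Aint_div_int (a : int) (q : nat) :
  (0 < q)%N -> a%:~R / q%:R \in Aint -> (q %| a)%Z.
Proof.
move=> q_gt0 A_aq.
have /intrP[m Dm] : (a%:~R / q%:R : algC) \is a Num.int.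
  by apply: Cint_rat_Aint => //; rewrite rpred_div ?rpred_nat ?rpred_int.
apply/dvdzP; exists m; apply: (@intr_inj algC).
by rewrite rmorphM /= -Dm divfK // pnatr_eq0 -lt0n.
Qed.

(** All conjugates of [(z - 1) / q] have modulus at most 2 / q < 1. *)
Lemma root1_cong1 (n q : nat) (z : algC) : (0 < n)%N -> z ^+ n = 1 ->
  (2 < q)%N -> (z - 1) / q%:R \in Aint -> z = 1.
Proof.
move=> n_gt0 zn1 q_gt2 Azq; have q_gt0 : (0 < q)%N by apply: leq_trans q_gt2.
have nzq : q%:R != 0 :> algC by rewrite pnatr_eq0 -lt0n.
suffices /eqP : (z - 1) / q%:R = 0.
  by rewrite mulf_eq0 invr_eq0 (negPf nzq) orbF subr_eq0 => /eqP.
apply: Aint_small_conjugates => // nu.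
rewrite rmorphM fmorphV /= rmorph_nat rmorphB rmorph1 normrM normfV normr_nat.
rewrite ltr_pdivrMr ?ltr0n // mul1r; apply: le_lt_trans (ler_normB _ _) _.
have /(norm_root1 _ _ n_gt0)-> : nu z ^+ n = 1 by rewrite -rmorphXn zn1 rmorph1.
by rewrite normr1 -[1 + 1]/(2%:R) ltr_nat.
Qed.

(* (u - u^* ) / (q u^* ) is an algebraic integer all of whose conjugates have
   modulus at most 2 / q < 1, because complex conjugation commutes with the
   automorphisms of a cyclotomic field. *)
Lemma cyclotomic_unit_real (n q : nat) (z : algC) (F : {poly int})
    (u := (pZtoC F).[z]) (u' := (pZtoC F).[z^-1]) :
  (0 < n)%N -> z ^+ n = 1 -> (2 < q)%N -> u != 0 -> u^-1 \in Aint ->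
  (u - u') / q%:R \in Aint -> u' = u.
Proof.
move=> n_gt0 zn1 q_gt2 nzu Au Auq.
have q_gt0 : (0 < q)%N by apply: leq_trans q_gt2.
have nzq : q%:R != 0 :> algC by rewrite pnatr_eq0 -lt0n.
have Du' : u' = u^* by rewrite aut_horner /= (conj_root1 _ _ n_gt0 zn1).
have nzu' : u' != 0 by rewrite Du' conjC_eq0.
suffices /eqP : (u - u') / q%:R / u' = 0.
  by rewrite !mulf_eq0 !invr_eq0 (negPf nzq) (negPf nzu') !orbF subr_eq0 => /eqP.
apply: Aint_small_conjugates => [|nu].
  by rewrite rpredM // Du' -fmorphV /= Aint_aut.
have nuz1 : nu z ^+ n = 1 by rewrite -rmorphXn zn1 rmorph1.
have Dnu : nu u' = (nu u)^*.
  by rewrite !aut_horner /= (conj_root1 _ _ n_gt0 nuz1) fmorphV.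
rewrite !rmorphM !fmorphV /= rmorph_nat rmorphB !normrM !normfV normr_nat.
rewrite ltr_pdivrMr ?normr_gt0 ?fmorph_eq0 // mul1r.
rewrite ltr_pdivrMr ?ltr0n //; apply: le_lt_trans (ler_normB _ _) _.
rewrite Dnu norm_conjC -mulr2n -[_ *+ 2]mulr_natr ltr_pM2l ?ltr_nat //.
by rewrite normr_gt0 fmorph_eq0.
Qed.

(** * Values at roots of unity are not units *)

(** Here [Y] plays the role of R / X^(i+1). Taking [F] and [Y] to be integer polynomials lets every
    automorphism act through its effect on [z] alone. *)
Lemma special_value_nonunit (p q n : nat) (a : int) (z : algC)
    (F Y : {poly int}) (u := (pZtoC F).[z]) :
  prime p -> (2 < q)%N -> ~~ (p %| a)%Z -> (0 < n)%N -> z ^+ n = 1 ->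
  u = 1 + q%:R * (a%:~R * z^-1 + p%:R * (pZtoC Y).[z]) ->
  u^-1 \notin Aint.
Proof.
move=> p_pr q_gt2 p'a n_gt0 zn1 Du; apply/negP=> Au.
have p_gt0 := prime_gt0 p_pr; have q_gt0 : (0 < q)%N by apply: leq_trans q_gt2.
have nzq : q%:R != 0 :> algC by rewrite pnatr_eq0 -lt0n.
have nzp : p%:R != 0 :> algC by rewrite pnatr_eq0 -lt0n.
have Az := Aint_root1 _ _ n_gt0 zn1.
have Nz := norm_root1 _ _ n_gt0 zn1.
have nzz : z != 0 by rewrite -normr_gt0 Nz ltr01.
have Dz := conj_root1 _ _ n_gt0 zn1.
have AzV : z^-1 \in Aint by rewrite -Dz Aint_aut.
have Ap : p%:R \in Aint by rewrite -[p%:R]/(p%:Z%:~R) Aint_int.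
have nzu : u != 0.
  apply/eqP=> u0; suffices : (q %| 1)%Z by rewrite dvdz1 /= eqn_leq leqNgt ltnW.
  apply: Aint_div_int => //.
  have -> : 1%:~R = - (q%:R * (a%:~R * z^-1 + p%:R * (pZtoC Y).[z])).
    by apply/eqP; rewrite -addr_eq0 -Du u0.
  rewrite -mulrN mulrC mulKf // rpredN.
  by rewrite rpredD ?rpredM ?Aint_int ?Aint_horner.
have Du' : (pZtoC F).[z^-1] = 1 + q%:R * (a%:~R * z + p%:R * (pZtoC Y).[z^-1]).
  rewrite -Dz -aut_horner -/u Du /= !(rmorphD, rmorphM) rmorph1 /= !aut_horner /=.
  by rewrite !rmorph_nat rmorph_int fmorphV /= Dz invrK.
have uE : u - (pZtoC F).[z^-1] = q%:R * (a%:~R * (z^-1 - z)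
    + p%:R * ((pZtoC Y).[z] - (pZtoC Y).[z^-1])).
  by rewrite Du Du'; ring.
have real_u : (pZtoC F).[z^-1] = u.
  apply: cyclotomic_unit_real n_gt0 zn1 q_gt2 nzu Au _.
  rewrite -/u uE mulrC mulKf //.
  by rewrite rpredD ?rpredM ?Aint_int ?rpredB ?Aint_horner.
have a_zzV : a%:~R * (z - z^-1) = p%:R * ((pZtoC Y).[z] - (pZtoC Y).[z^-1]).
  move/esym/eqP: uE; rewrite real_u subrr mulf_eq0 (negPf nzq) addrC addr_eq0.
  by move/eqP->; rewrite -mulrN opprB.
(* Since p divides a (z - 1/z) and is prime to [a], a Bezout relation gives that p divides z -
   1/z. *)
have [[s t] /= Dst] : exists uv : int * int, uv.1 * a + uv.2 * p%:Z = 1.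
  by apply/coprimezP; rewrite coprimezE coprime_sym prime_coprime.
have A_zzV : (z - z^-1) / p%:R \in Aint.
  have -> : (z - z^-1) / p%:R = s%:~R * ((pZtoC Y).[z] - (pZtoC Y).[z^-1])
       + t%:~R * (z - z^-1).
    have D1 : s%:~R * a%:~R + t%:~R * p%:R = 1 :> algC.
      by rewrite -[p%:R]/(p%:Z%:~R) -!rmorphM -rmorphD Dst.
    apply: (mulIf nzp); rewrite divfK //.
    transitivity ((s%:~R * a%:~R + t%:~R * p%:R) * (z - z^-1)).
      by rewrite D1 mul1r.
    by rewrite mulrDl -[X in X + _]mulrA a_zzV; ring.
  by rewrite rpredD ?rpredM ?Aint_int ?rpredB ?Aint_horner.
have A_z2 : (z ^+ 2 - 1) / p%:R \in Aint.
  have -> : (z ^+ 2 - 1) / p%:R = z * ((z - z^-1) / p%:R).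
    by field; rewrite nzp nzz.
  by rewrite rpredM.
(* If z is 1 or -1, then [u] is a rational integer and a unit. The value 1 would make p divide [a],
   and the value -1 would make [q] divide 2. *)
have [z2 | nz2] := eqVneq (z ^+ 2) 1.
  have zVz : z^-1 = z by apply: (mulfI nzz); rewrite mulfV // -expr2 z2.
  have int_z : z \is a Num.int.
    by move/eqP: z2; rewrite sqrf_eq1 => /pred2P[]->; rewrite ?rpredN rpred1.
  have int_u : u \is a Num.int by apply: Cint_horner.
  have int_uV : u^-1 \is a Num.int.
    apply: Cint_rat_Aint Au; case/intrP: int_u => m ->.
    by rewrite rpredV rpred_int.
  have DX : q%:R * (a%:~R * z^-1 + p%:R * (pZtoC Y).[z]) = u - 1.
    by apply/esym/eqP; rewrite subr_eq addrC -Du.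
  have : `|u| == 1.
    rewrite eq_le -{1}[u]invrK normfV invf_le1 ?normr_gt0 ?invr_eq0 //.
    by rewrite !norm_intr_ge1 ?invr_eq0.
  rewrite -(@pexpr_eq1 _ _ 2) // intr_normK // sqrf_eq1 => /pred2P[u1 | uN1].
    move/negP: p'a; apply; apply: Aint_div_int => //.
    have -> : a%:~R / p%:R = - (z * (pZtoC Y).[z]).
      apply: (mulIf nzp); rewrite divfK //.
      move/esym/eqP: DX; rewrite u1 subrr eq_sym mulf_eq0 (negPf nzq) /=.
      rewrite addr_eq0 zVz => /eqP/(congr1 (fun x => x * z)).
      by rewrite -mulrA -expr2 z2 mulr1 => ->; ring.
    by rewrite rpredN rpredM ?Aint_horner.
  suffices : (q %| 2%:Z)%Z by rewrite dvdzE gtnNdvd.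
  apply: Aint_div_int => //.
  have -> : 2%:Z%:~R = - (q%:R * (a%:~R * z^-1 + p%:R * (pZtoC Y).[z])).
    by rewrite DX uN1 opprB opprK.
  rewrite -mulrN mulrC mulKf // rpredN.
  by rewrite rpredD ?rpredM ?Aint_int ?Aint_horner.
have p2 : p = 2%N.
  apply/eqP; apply: contraR nz2 => p_neq2; apply/eqP.
  apply: (@root1_cong1 n p) A_z2 => //; first by rewrite exprAC zn1 expr1n.
  by rewrite ltn_neqAle eq_sym p_neq2 prime_gt1.
(* With w = (z^2 - 1) / 2 an algebraic integer, (z^4 - 1) / 4 = w (w + 1) is one too, and the
   modulus 4 exceeds 2. *)
have z4 : (z ^+ 2) ^+ 2 = 1.
  apply: (@root1_cong1 n 4) => //.
    by rewrite exprAC [z ^+ 2 ^+ n]exprAC zn1 !expr1n.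
  have -> : ((z ^+ 2) ^+ 2 - 1) / 4%:R
     = (z ^+ 2 - 1) / 2%:R * ((z ^+ 2 - 1) / 2%:R + 1) by field.
  by rewrite p2 in A_z2; rewrite rpredM ?rpredD ?rpred1.
have z2N : z ^+ 2 = -1.
  by move/eqP: z4; rewrite sqrf_eq1 (negPf nz2) => /eqP.
have zVz : z^-1 = - z.
  by apply: (mulfI nzz); rewrite mulfV // mulrN -expr2 z2N opprK.
(* Now 1/z = -z, so [a_zzV] reads a z = Y(z) - Y(-z) after division by 2. The right side is
   divisible by 2, hence so is [a], against the hypothesis. *)
move/negP: p'a; apply; apply: Aint_div_int => //.
have -> : a%:~R / p%:R = ((pZtoC Y).[- z] - (pZtoC Y).[z]) / 2 * z.
  have nz2R : 2 != 0 :> algC by rewrite pnatr_eq0.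
  move: a_zzV; rewrite zVz p2 opprK => /eqP.
  have -> : a%:~R * (z + z) = 2 * (a%:~R * z) by ring.
  rewrite (inj_eq (mulfI nz2R)) => /eqP E.
  have -> : a%:~R = - (a%:~R * z * z) by rewrite -mulrA -expr2 z2N; ring.
  by rewrite E; field.
by rewrite rpredM ?Aint_horner_oppB.
Qed.

(** * Resultants with cyclotomic polynomials *)

Lemma root_pZtoC_dvdp (f g : {poly int}) (z : algC) :
  (f %| g)%R -> root (pZtoC f) z -> root (pZtoC g) z.
Proof.
(* Over [int], divisibility means that some nonzero multiple [c *: g] is a multiple of [f]. *)
case/Pdiv.Idomain.dvdpP=> -[c h] /= nz_c Dg fz0.
rewrite -(rootZ _ _ (_ : c%:~R != 0 :> algC)) ?intr_eq0 //.
by rewrite -map_polyZ Dg rmorphM rootM fz0 orbT.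
Qed.

Lemma root_Cyclotomic (l : nat) (z : algC) :
  (0 < l)%N -> root (pZtoC 'Phi_l) z = l.-primitive_root z.
Proof.
move=> l_gt0; have [w prim_w] := C_prim_root_exists l_gt0.
by rewrite (Cintr_Cyclotomic prim_w) root_cyclotomic.
Qed.

(* When the resultant vanishes the value below is 0^-1 = 0. *)
Lemma resultant_Cyclotomic_le1 (P : {poly int}) (l : nat) :
  (0 < l)%N -> (1 < size P)%N -> `|resultant P 'Phi_l| <= 1 ->
  exists2 z : algC, l.-primitive_root z & (pZtoC P).[z]^-1 \in Aint.
Proof.
move=> l_gt0 P_gt1; have [r0 _ | nzr r_le1] := eqVneq (resultant P 'Phi_l) 0.
  move/eqP: r0; rewrite resultant_eq0 => sz_gcd.
  have /closed_rootP[z gz0] : size (pZtoC (gcdp P 'Phi_l)) != 1.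
    rewrite size_map_inj_poly ?rmorph0 //; last exact: intr_inj.
    by case: ltngtP sz_gcd.
  exists z.
    rewrite -root_Cyclotomic //.
    exact: (root_pZtoC_dvdp _ _ _ (dvdp_gcdr _ _) gz0).
  by rewrite (rootP (root_pZtoC_dvdp _ _ _ (dvdp_gcdl _ _) gz0)) invr0 rpred0.
have [z prim_z] := C_prim_root_exists l_gt0; exists z => //.
have Phi_gt1 : (1 < size 'Phi_l)%N by rewrite size_Cyclotomic ltnS totient_gt0.
(* The resultant r is a combination of [P] and ['Phi_l]; at [z] only the multiple of P(z) survives.
   As r is 1 or -1, P(z) is a unit. *)
have [[U V] _ /= DUV] := resultant_in_ideal P_gt1 Phi_gt1.
set r := resultant P 'Phi_l in nzr r_le1 DUV.
have r2 : r * r = 1.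
  by rewrite -expr2 -real_normK ?num_real // (_ : `|r| = 1) //; lia.
have UPr : (pZtoC U).[z] * (pZtoC P).[z] = r%:~R.
  rewrite -hornerM -rmorphM -[RHS](hornerC _ z) -map_polyC DUV rmorphD hornerD /=.
  rewrite [in X in _ + X]rmorphM hornerM; suff /rootP-> : root (pZtoC 'Phi_l) z.
    by rewrite mulr0 addr0.
  by rewrite root_Cyclotomic.
have -> : (pZtoC P).[z]^-1 = r%:~R * (pZtoC U).[z].
  by apply: mulr1_eq; rewrite mulrC -mulrA UPr -rmorphM r2.
by rewrite rpredM ?Aint_int ?Aint_horner ?(Aint_prim_root prim_z).
Qed.

(** * Special polynomials *)

Lemma pspecial_decomposition (p : nat) (P : {poly int}) :
    prime p -> pspecial p P -> P <> 'X ->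
  exists (i q : nat) (a : int) (R : {poly int}),
    [/\ (2 < q)%N, ~~ (p %| a)%Z
      & P = 'X^(i.+1) + q%:Z%:P * (a%:P * 'X^i + p%:Z%:P * R)].
Proof.
move=> p_pr [monP]; case Di: (size P).-1 => [//|i] _.
rewrite subn1 /= => v2 vP PnX.
have szP : size P = i.+2 by rewrite -Di prednK // size_poly_gt0 monic_neq0.
have lcP : P`_i.+1 = 1 by rewrite -(monicP monP) lead_coefE szP.
(* A zero coefficient has valuation +oo, which no lower coefficient can exceed. So there is none,
   and [P] is ['X], which is excluded. *)
have nzA : P`_i != 0.
  apply/eqP=> A0; case: i => [|i] in Di v2 vP szP lcP A0 *.
    case: PnX; apply/polyP=> -[|[|j]]; rewrite ?coefX //=.
    by rewrite nth_default // szP.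
  by have := vP 0 isT; rewrite /padicv A0 eqxx; case: ifP.
pose v := logn p `|P`_i|.
have p_gt1 := prime_gt1 p_pr.
(* [q] is the exact power of p in the subleading coefficient and [a] its cofactor; the lower
   coefficients are divisible by p q. *)
exists i, (p ^ v)%N, (P`_i %/ (p ^ v)%N)%Z,
   (\poly_(j < i) (P`_j %/ (p ^ v.+1)%N)%Z).
have pv_A : ((p ^ v)%N %| P`_i)%Z by rewrite dvdzE /= pfactor_dvdnn.
split.
- move: v2; rewrite /padicv (negPf nzA) /= lte_fin ltz_nat -/v => v2.
  (* For p = 2 the valuation is at least 2, so q >= 4; for odd p it is at least 1, so q >= p > 2. *)
  have [p2 | p_neq2] := eqVneq p 2%N.
    rewrite p2 in v2 *; apply: (@leq_trans (2 ^ 2)) => //.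
    by rewrite leq_exp2l.
  have p_gt2 : (2 < p)%N by rewrite ltn_neqAle eq_sym p_neq2.
  apply: (leq_trans p_gt2); rewrite -{1}[p]expn1 leq_exp2l //.
  exact: leq_ltn_trans v2.
- apply/negP=> /dvdzP[b Db].
  have : ((p ^ v.+1)%N %| P`_i)%Z.
    by rewrite -(divzK pv_A) Db expnS PoszM -mulrA dvdz_mull.
  by rewrite dvdzE /= pfactor_dvdn ?absz_gt0 // ltnn.
apply/polyP=> j; rewrite coefD coefXn coefCM coefD !coefCM coefXn coef_poly.
have [-> | nji] := eqVneq j i.
  by rewrite ltnn mulr0 addr0 eqn_leq ltnn andbF add0r mulr1 mulrC divzK.
case: ltnP => [ltji | leij]; last first.
  rewrite !(mulr0, addr0); case: (eqVneq j) => [-> // | nji1].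
  by rewrite nth_default // szP; lia.
rewrite (_ : (j == i.+1) = false); last by lia.
rewrite mulr0 !add0r mulrA -PoszM mulnC -expnS mulrC divzK //.
have := vP j ltji; rewrite /padicv (negPf nzA).
have [-> _ | nzj] := eqVneq P`_j 0; first exact: dvdz0.
by rewrite lte_fin ltz_nat dvdzE /= pfactor_dvdn ?absz_gt0.
Qed.

Theorem theorem6p2 (p : nat) (P : {poly int})
    (p_prime : prime p) (P_special : pspecial p P)
    (P_neqX : P <> 'X)
    (l : nat) (l_ge1 : (1 <= l)%N) :
  1 < `|resultant P 'Phi_l|.
Proof.
have P_gt1 : (1 < size P)%N by case: P_special => _ + _ _; case: size => [|[]].
have [i [q [a [R [q_gt2 p'a DP]]]]] :=
  pspecial_decomposition _ _ p_prime P_special P_neqX.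
rewrite ltNge; apply/negP=> r_le1.
have [z prim_z Au] := resultant_Cyclotomic_le1 _ _ l_ge1 P_gt1 r_le1.
have zl1 := prim_expr_order prim_z.
have Az := Aint_prim_root prim_z.
have zV : z ^+ l.-1 = z^-1.
  by apply/esym/mulr1_eq; rewrite -exprS prednK.
have nzz : z != 0.
  apply/eqP=> z0; move/eqP: zl1.
  by rewrite z0 expr0n eqn0Ngt l_ge1 eq_sym oner_eq0.
have DPz : (pZtoC P).[z]
    = z ^+ i.+1 + q%:R * (a%:~R * z ^+ i + p%:R * (pZtoC R).[z]).
  rewrite DP rmorphD rmorphM rmorphD !rmorphM /= !map_polyXn !map_polyC.
  by rewrite !(hornerD, hornerM, hornerC, hornerXn).
(* As z^(l-1) = 1/z, multiplying by X^m divides the value at [z] by z^(i+1) while keeping integer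
   polynomials. *)
pose m := (l.-1 * i.+1)%N.
have zm : z ^+ m = z ^- i.+1 by rewrite exprM zV exprVn.
have := special_value_nonunit p q l a z (P * 'X^m) (R * 'X^m)
  p_prime q_gt2 p'a l_ge1 zl1.
rewrite !rmorphM /= map_polyXn !hornerM hornerXn zm => /(_ _)/negP[].
  by rewrite DPz exprS; field; rewrite expf_neq0.
by rewrite invfM invrK rpredM ?rpredX.
Qed.
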